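(* The following two assertions hold. (i) Under the translation $\sigma$ (acting coordinatewise) the space $\mathcal{B}([-1,1])^{\mathbb{N}}$ is not universal; that is, there is a real flow that cannot be embedded in it. (ii) Under the translation $\sigma$ (acting coordinatewise) the space $\prod_{n=0}^{+\infty}\mathcal{B}\left([-n/3-1/2,-n/3]\cup[n/3,n/3+1/2]\right)$ is not universal; that is, there is a real flow that cannot be embedded in it.
   Context: A real flow $(X,\mathbb{R},T)$ is a compact metric space $X$ with a continuous map $T:\mathbb{R}\times X\to X$, $(t,x)\mapsto T_tx$, with $T_0x=x$ and $T_{r+s}x=T_rT_sx$. A flow $(Y,\mathbb{R},S)$ can be embedded in $(X,\mathbb{R},T)$ if there is a homeomorphism $\phi$ of $Y$ into $X$ (onto its image) with $\phi(S_ty)=T_t\phi(y)$ for all $t\in\mathbb{R}$, $y\in Y$. A real flow is universal if all real flows can be embedded in it. Function spaces on $\mathbb{R}$ carry the topology of uniform convergence on compact subsets, given by $D(f,g)=\sum_{n\ge1}2^{-n}\|f-g\|_{L^\infty([-n,n])}$. The translation is $\sigma_t f=f(\cdot+t)$. Products carry the product topology, and $\mathbb{R}$ acts on them by translating every coordinate. For compact $I\subset\mathbb{R}$, a bounded continuous $f:\mathbb{R}\to\mathbb{C}$ is band-limited in $I$ if $\mathrm{supp}(\mathcal{F}(f))\subset I$, where $\mathcal{F}(f)$ is the Fourier transform of $f$ as a tempered distribution (extending $\mathcal{F}(f)(\xi)=\int_{\mathbb{R}}e^{-2\pi\sqrt{-1}t\xi}f(t)\,dt$); i.e. $\langle\mathcal{F}(f),g\rangle=0$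 for all rapidly decreasing (Schwartz) $g:\mathbb{R}\to\mathbb{C}$ with $\mathrm{supp}(g)\cap I=\emptyset$. $\mathcal{B}(I)$ is the set of continuous $f:\mathbb{R}\to\mathbb{R}$ band-limited in $I$ with $\|f\|_{L^\infty(\mathbb{R})}\le1$; it is compact and translation invariant. *)

(* Defs.v *)
From HB Require Import structures.
From mathcomp Require Import all_boot all_order all_algebra.
From mathcomp Require Import all_classical all_reals all_analysis.
From mathcomp Require Import complex.

Set Implicit Arguments.
Unset Strict Implicit.
Unset Printing Implicit Defensive.

Import Order.TTheory GRing.Theory Num.Theory.
Import numFieldNormedType.Exports.

Local Open Scope classical_set_scope.
Local Open Scope ring_scope.

Record real_flow (R : realType) := RealFlow {
  flow_space :> metricType R ;
  flow_act : R -> flow_space -> flow_space ;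
  flow_compact : compact [set: flow_space] ;
  flow_continuous :
    continuous (fun p : R * flow_space => flow_act p.1 p.2) ;
  flow_act0 : forall x, flow_act 0 x = x ;
  flow_actD : forall r s x, flow_act (r + s) x = flow_act r (flow_act s x) }.

(* The target of an embedding is a subset [A] of an ambient topological space
   [X] on which [R] acts by [T]; [A] is meant to be [T]-invariant, and carries
   the subspace topology. The third clause says that [phi] is open onto its
   image, so that [phi] is a homeomorphism onto its image. An explicit inverse
   [X -> Y] would not do: it does not exist when [Y] is empty. *)
Definition embeds_in (R : realType) (Y : real_flow R)
    (X : topologicalType) (T : R -> X -> X) (A : set X) : Prop :=
  exists phi : Y -> X,
    [/\ continuous phi,
        injective phi,
        (forall U : set Y, open U ->
           exists2 V : set X, open V & phi @` U = V `&` range phi),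
        range phi `<=` A &
        forall (t : R) (y : Y), phi (flow_act t y) = T t (phi y)].

Definition universal (R : realType)
    (X : topologicalType) (T : R -> X -> X) (A : set X) : Prop :=
  forall Y : real_flow R, embeds_in Y T A.

(* Derivatives and integrals of complex-valued functions of a real variable
   are taken componentwise. *)
Definition real_schwartz (R : realType) (u : R -> R) : Prop :=
  forall n : nat,
    (forall x : R, derivable (derive1n n u) x 1) /\
    (forall k : nat, exists M : R, forall x : R,
       `|x ^+ k * derive1n n u x| <= M).

Definition schwartz (R : realType) (g : R -> R[i]) : Prop :=
  real_schwartz (fun x => complex.Re (g x)) /\
  real_schwartz (fun x => complex.Im (g x)).

Definition cintegral (R : realType) (h : R -> R[i]) : R[i] :=
  Complex (Rintegral lebesgue_measure setT (fun x => complex.Re (h x)))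
          (Rintegral lebesgue_measure setT (fun x => complex.Im (h x))).

Definition cexpi (R : realType) (t : R) : R[i] := Complex (cos t) (sin t).

Definition fourier (R : realType) (g : R -> R[i]) (xi : R) : R[i] :=
  cintegral (fun t => cexpi (- (2 * pi * t * xi)) * g t).

(* For bounded continuous [f], [fourier_pairing f g] is <F(f), g>, since the
   Fourier transform of a tempered distribution is defined by
   <F(f), g> = <f, F(g)>. *)
Definition fourier_pairing (R : realType) (f g : R -> R[i]) : R[i] :=
  cintegral (fun t => f t * fourier g t).

Definition spectrum_in (R : realType) (I : set R) (f : R -> R[i]) : Prop :=
  forall g : R -> R[i], schwartz g ->
    closure [set x | g x != 0] `&` I = set0 -> fourier_pairing f g = 0.

(* Uniform convergence on compact sets. *)
Definition signal (R : realType) : topologicalType :=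
  {family (@compact R), R -> R}.

Definition band_limited_ball (R : realType) (I : set R) : set (signal R) :=
  [set f : R -> R | [/\ continuous f,
    spectrum_in I (fun t => Complex (f t) 0) &
    (Lnorm lebesgue_measure +oo (EFin \o f) <= 1)%E]].

Definition signals (R : realType) : topologicalType :=
  prod_topology (fun _ : nat => signal R).

Definition translation (R : realType) (t : R) (x : signals R) : signals R :=
  fun n s => (x n : R -> R) (s + t).

Definition band_limited_prod (R : realType) (I : nat -> set R)
    : set (signals R) :=
  [set x | forall n : nat, band_limited_ball (I n) (x n)].

(* Main.v *)
Require Import Defs.
From HB Require Import structures.
From mathcomp Require Import all_boot all_order all_algebra.
From mathcomp Require Import all_classical all_reals all_analysis.
From mathcomp Require Import measurable_realfun complex ring lra.

(** (i) A p-periodic signal band-limited in [-1, 1] is constant once p is small: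
    it is reproduced by convolution with a fixed integrable kernel, and the
    L^1-modulus of continuity of that kernel makes its oscillation over a period
    strictly less than itself. So a circle rotating with a short period does not
    embed. The kernel is the Fourier transform of a smooth plateau [a] equal to
    a constant near [-1, 1]: since [a (x / r) - a x] vanishes near [-1, 1] for
    r >= 1, the convolutions with the dilated kernels all agree, and r -> oo
    gives the reproducing formula.
    (ii) The fixed points of the product are constant signals, and only the
    factor n = 0 has the frequency 0 in its band; hence they form a subset of a
    line, and the circle with the trivial flow does not embed. *)

Set Implicit Arguments.
Unset Strict Implicit.
Unset Printing Implicit Defensive.

Import Order.TTheory GRing.Theory Num.Theory.
Import numFieldNormedType.Exports.

Local Open Scope classical_set_scope.
Local Open Scope ring_scope.

(** * Smooth functions and a plateau *)

(** Fourier inversion would identify the integral of [plateau_hat] with [plateau 0]. Positivity of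
    this integral is enough: in (i) it is the constant against which the modulus of continuity is
    measured, in (ii) the factor that multiplies a constant signal. It follows from the plateau
    being nonnegative and constant around 0. Band limitation is tested only against real, smooth,
    compactly supported functions built from dilated plateaus, so complex pairings reduce to the
    real integral [cosint]. The reproducing formula is proved at the point 0 alone. Other points are
    reached by translating the signal, and the spectra of the translates are known because the orbit
    of a point is mapped into the product. Strictness in (i) comes from centring the signal at the
    middle of its range, which replaces the oscillation by half of it. *)

Section smooth_functions.
Context {R : realType}.
Implicit Types (f g : R -> R) (n : nat) (x : R).

(** Derivatives are peeled off from the inside, so that after one step [derive1 f] can be rewritten
    by a product or chain rule before the induction hypothesis is applied. *)
Fixpoint ndiff n f : Prop :=
  if n is m.+1 then (forall x, derivable f x 1) /\ ndiff m (derive1 f) else True.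

Definition smooth f := forall n, ndiff n f.

Lemma ndiffS n f : ndiff n.+1 f -> ndiff n f.
Proof.
elim: n f => [//|n IH] f [df /IH d'f]; split => //.
Qed.

Lemma smooth_derivable f : smooth f -> forall x, derivable f x 1.
Proof. by move=> /(_ 1%N) []. Qed.

Lemma smooth_derive1 f : smooth f -> smooth (derive1 f).
Proof. by move=> sf n; have [] := sf n.+1. Qed.

Lemma smooth_continuous f : smooth f -> continuous f.
Proof.
move=> sf x; apply: differentiable_continuous.
exact/derivable1_diffP/smooth_derivable.
Qed.

Lemma smooth_derive1n f n : smooth f -> smooth (derive1n n f).
Proof. by move=> sf; elim: n => [//|n IH]; exact: (smooth_derive1 IH). Qed.

(** A family closed under derivation replaces a formula for the n-th derivative. *)
Lemma coind_smooth (P : (R -> R) -> Prop) :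
  (forall f, P f -> (forall x, derivable f x 1) /\ P (derive1 f)) ->
  forall f, P f -> smooth f.
Proof.
move=> Pstep f Pf n; elim: n f Pf => [//|n IH] f /Pstep[df Pf'].
by split => //; exact: IH.
Qed.

Lemma derive1_cst_fun (c : R) : (fun=> c : R)^`()%classic = (fun=> 0).
Proof. by apply/funext => x; rewrite derive1_cst. Qed.

Lemma smooth_cst (c : R) : smooth (fun=> c).
Proof.
apply: (@coind_smooth (fun f => exists c, f = fun=> c)); last by exists c.
move=> _ [b ->]; split; first by move=> x; exact: derivable_cst.
by exists 0; rewrite derive1_cst_fun.
Qed.

Lemma smooth_id : smooth id.
Proof.
move=> [//|n]; split; first by move=> x; exact: derivable_id.
rewrite (_ : derive1 id = (fun=> 1)); first exact: smooth_cst.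
by apply/funext => x; rewrite derive1_id.
Qed.

Lemma ndiffD n f g : ndiff n f -> ndiff n g -> ndiff n (fun x => f x + g x).
Proof.
elim: n f g => [//|n IH] f g [df f'] [dg g']; split.
  by move=> x; exact: derivableD.
rewrite (_ : derive1 _ = (fun x => (derive1 f) x + (derive1 g) x)); first exact: IH.
by apply/funext => x; rewrite !derive1E deriveD.
Qed.

Lemma ndiffM n f g : ndiff n f -> ndiff n g -> ndiff n (fun x => f x * g x).
Proof.
elim: n f g => [//|n IH] f g df dg; split.
  by move=> x; apply: derivableM; [exact: df.1|exact: dg.1].
rewrite (_ : derive1 _ = (fun x => f x * (derive1 g) x + g x * (derive1 f) x)).
  by apply: ndiffD; apply: IH;
    [exact: ndiffS|exact: dg.2|exact: ndiffS|exact: df.2].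
apply/funext => x; rewrite !derive1E.
by rewrite (@deriveM _ _ f g)//; [exact: df.1|exact: dg.1].
Qed.

Lemma ndiff_comp n f g : ndiff n f -> ndiff n g -> ndiff n (f \o g).
Proof.
elim: n f g => [//|n IH] f g df dg; split.
  move=> x; apply/derivable1_diffP/differentiable_comp;
    apply/derivable1_diffP; [exact: dg.1|exact: df.1].
rewrite (_ : derive1 _ = (fun x => ((derive1 f) \o g) x * (derive1 g) x)).
  apply: ndiffM; last exact: dg.2.
  by apply: IH; [exact: df.2|exact: ndiffS].
apply/funext => x.
by rewrite derive1_comp//; [exact: dg.1|exact: df.1].
Qed.

Lemma smoothD f g : smooth f -> smooth g -> smooth (fun x => f x + g x).
Proof. by move=> sf sg n; exact: ndiffD. Qed.

Lemma smoothM f g : smooth f -> smooth g -> smooth (fun x => f x * g x).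
Proof. by move=> sf sg n; exact: ndiffM. Qed.

Lemma smooth_comp f g : smooth f -> smooth g -> smooth (f \o g).
Proof. by move=> sf sg n; exact: ndiff_comp. Qed.

Lemma smoothZ (c : R) f : smooth f -> smooth (fun x => c * f x).
Proof. by move=> sf; apply: smoothM => //; exact: smooth_cst. Qed.

Lemma smoothB f g : smooth f -> smooth g -> smooth (fun x => f x - g x).
Proof.
move=> sf sg; have := smoothD sf (smoothZ (-1) sg).
by under [X in smooth X -> _]funext do rewrite mulN1r.
Qed.

End smooth_functions.

(** * Flat functions and the smooth plateau *)

Section flat_functions.
Context {R : realType}.
Implicit Types (p : {poly R}) (x : R).

(** The polynomial makes the family that contains exp(-1/x) closed under derivation: for x > 0 the
    derivative of p(1/x) exp(-1/x) is x^(-2) (p - p')(1/x) exp(-1/x). *)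
Definition flat p x := if 0 < x then p.[x^-1] * expR (- x^-1) else 0.

(** A single term y^n / n! of the exponential series already bounds the monomial y^n by n!
    exp(y). *)
Lemma expR_poly_bound p :
  exists C, forall y, 0 < y -> `|p.[y]| * expR (- y) <= C.
Proof.
have mono n (y : R) : 0 < y -> y ^+ n * expR (- y) <= n`!%:R.
  move=> y0; rewrite expRN ler_pdivrMr ?expR_gt0// -ler_pdivrMl ?ltr0n ?fact_gt0//.
  case: n => [|n].
    by rewrite fact0 invr1 mul1r expr0 -expR0 ler_expR ltW.
  by apply: le_trans (expR_ge1Dxn n (ltW y0)); rewrite mulrC lerDr.
exists (\sum_(i < size p) `|p`_i| * (i`!)%:R) => y y0.
rewrite horner_coef; apply: (@le_trans _ _
    ((\sum_(i < size p) `|p`_i * y ^+ i|) * expR (- y))).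
  by rewrite ler_wpM2r ?expR_ge0// ler_norm_sum.
rewrite mulr_suml; apply: ler_sum => i _.
rewrite normrM normrX (gtr0_norm y0) -mulrA.
by rewrite ler_wpM2l// mono.
Qed.

Lemma flat_le0 p x : x <= 0 -> flat p x = 0.
Proof. by move=> x0; rewrite /flat ltNge x0. Qed.

Lemma is_derive_flat p x :
  is_derive x (1 : R) (flat p) (flat ('X^2 * (p - p^`())) x).
Proof.
have [x0|x0|->] := ltgtP x 0.
- rewrite flat_le0; last exact: ltW.
  have H0 : is_derive x (1 : R) (cst (0 : R)) 0 by exact: is_derive_cst.
  apply: near_eq_is_derive H0.
  near=> y; rewrite flat_le0// ltW//.
  by near: y; exact: lt_nbhsl.
- have xV : is_derive x (1 : R) (fun y => y^-1) (- x ^- 2).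
    have := @is_deriveV _ id x 1 1 (lt0r_neq0 x0) (is_derive_id _ _).
    by move/is_derive_eq; apply; rewrite scaler1.
  apply: (@near_eq_is_derive _ R R
      ((horner p \o (fun y => y^-1)) * (expR \o (fun y => - y^-1)))).
    near=> y; have y0 : 0 < y by near: y; exact: lt_nbhsr.
    by rewrite /flat y0.
  apply: is_derive_eq.
  rewrite /flat x0 !hornerE /= /GRing.scale/=. by field; rewrite gt_eqF.
- rewrite flat_le0//; apply/is_derive1_caratheodory.
  (* The slope of [flat p] at 0 is itself flat, since p(1/y) = y * (1/y) p(1/y). *)
  exists (flat ('X * p)); split; last by rewrite flat_le0.
    move=> z; rewrite (@flat_le0 p 0)// !subr0 /flat; case: ltP => z0.
      by rewrite !hornerE; field; rewrite gt_eqF.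
    by rewrite mul0r.
  (* A second factor X is traded for a factor [|y|], which makes the slope tend to 0. *)
  have [C HC] := expR_poly_bound ('X^2 * p).
  have C0 : 0 <= C.
    by apply: le_trans (HC 1 ltr01); rewrite mulr_ge0 ?expR_ge0.
  have H y : `|flat ('X * p) y| <= C * `|y|.
    have [y0|y0] := leP y 0; first by rewrite flat_le0// normr0 mulr_ge0.
    have yV0 : 0 < y^-1 by rewrite invr_gt0.
    have := HC _ yV0; rewrite /flat y0 !hornerE 4!normrM (gtr0_norm (expR_gt0 _)).
    rewrite (gtr0_norm yV0) (gtr0_norm y0) => H.
    rewrite -ler_pdivrMr// (le_trans _ H)//.
    by rewrite le_eqVlt; apply/orP; left; apply/eqP; ring.
  rewrite /prop_for /continuous_at flat_le0//; apply/cvgrPdist_le => e e0; near=> h.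
  rewrite sub0r normrN; apply: (le_trans (H h)).
  have : `|h| <= e / (C + 1).
    by near: h; apply: (@nbhs0_le _ R); rewrite divr_gt0// ltr_wpDl.
  rewrite ler_pdivlMr ?ltr_wpDl// mulrDr mulr1 mulrC.
  by apply: le_trans; rewrite lerDl.
Unshelve. all: by end_near.
Qed.

Lemma smooth_flat p : smooth (flat p).
Proof.
apply: (@coind_smooth _ (fun f => exists p, f = flat p)); last by exists p.
move=> _ [q ->]; split=> [x|]; first by have [] := is_derive_flat q x.
exists ('X^2 * (q - q^`())); apply/funext => x; rewrite derive1E.
by have [_ ->] := is_derive_flat q x.
Qed.

(** The inner [flat 1] vanishes exactly on [-2, 2] and exceeds 1/2 outside
    [-3, 3]. *)
Definition plateau x := flat 1 (1 / 2 - flat 1 (x ^+ 2 - 4)).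

Lemma flat1_ge0 x : 0 <= flat 1 x.
Proof. by rewrite /flat; case: ifP => // _; rewrite hornerE mul1r expR_ge0. Qed.

Lemma plateau_ge0 x : 0 <= plateau x. Proof. exact: flat1_ge0. Qed.

Lemma smooth_plateau : smooth plateau.
Proof.
have sq : smooth (fun x : R => x ^+ 2 - 4).
  apply: smoothB; last exact: smooth_cst.
  by apply: smoothM; exact: smooth_id.
apply: (@smooth_comp _ (flat 1) (fun x => 1 / 2 - flat 1 (x ^+ 2 - 4))).
  exact: smooth_flat.
apply: smoothB; first exact: smooth_cst.
apply: (@smooth_comp _ (flat 1) (fun x => x ^+ 2 - 4)) => //.
exact: smooth_flat.
Qed.

Lemma plateau_inner x : `|x| <= 2 -> plateau x = plateau 0.
Proof.
move=> x2; rewrite /plateau.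
have h y : `|y| <= 2 -> flat 1 (y ^+ 2 - 4) = 0.
  move=> y2; apply: flat_le0; rewrite subr_le0 -real_normK ?num_real//.
  have -> : (4 : R) = 2 ^+ 2 by ring.
  by rewrite lerXn2r ?nnegrE.
by rewrite !h// normr0.
Qed.

Lemma plateau0_gt0 : 0 < plateau 0.
Proof.
rewrite /plateau (@flat_le0 1 (0 ^+ 2 - 4)); last by rewrite expr0n/=; lra.
by rewrite /flat subr0 ifT ?divr_gt0// hornerE ?mul1r expR_gt0.
Qed.

Lemma plateau_outer x : 3 <= `|x| -> plateau x = 0.
Proof.
move=> x3; rewrite /plateau flat_le0//.
have x9 : 9 <= x ^+ 2.
  rewrite -real_normK ?num_real//.
  have -> : (9 : R) = 3 ^+ 2 by ring.
  by rewrite lerXn2r ?nnegrE.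
rewrite /flat ifT; last by lra.
rewrite hornerE ?mul1r subr_le0.
(* The bound exp(-s) >= 1 - s with s = 1 / (x^2 - 4) at most 1/2 makes the outer argument
   nonpositive. *)
have e := expR_ge1Dx (- (x ^+ 2 - 4)^-1).
suff H : (x ^+ 2 - 4)^-1 <= 2^-1 by rewrite hornerC mul1r; apply: le_trans e; lra.
by rewrite lef_pV2 ?posrE; lra.
Qed.

End flat_functions.

(** * Smooth functions of compact support are Schwartz functions *)

Section compactly_supported.
Context {R : realType}.
Implicit Types (g : R -> R) (M : R).

Lemma derive1n_outside g M n : (forall x, M < `|x| -> g x = 0) ->
  forall x, M < `|x| -> derive1n n g x = 0.
Proof.
move=> g0; elim: n => [//|n IH] x Mx.
rewrite /derive1n iterS -/(derive1n n g) derive1E.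
rewrite (@near_eq_derive _ _ _ _ (fun=> 0)) ?derive_cst ?oner_neq0//.
near=> y; apply: IH; near: y.
apply: (@cvgr_gt _ _ (nbhs x) _ (fun y : R => `|y|) `|x|) => //; exact: (@norm_continuous R R).
Unshelve. all: by end_near. Qed.

Lemma continuous_outside_bounded g M : continuous g ->
  (forall x, M < `|x| -> g x = 0) -> exists C, forall x, `|g x| <= C.
Proof.
move=> cg g0.
have [M0|M0] := ltP M 0.
  by exists 0 => x; rewrite g0 ?normr0// (lt_le_trans M0).
have MM : - M <= M by lra.
have [c _ Hc] : exists2 c, c \in `[(- M), M] &
    forall t, t \in `[(- M), M] -> `|g t| <= `|g c|.
  apply: (@EVT_max _ (fun x => `|g x|)) => //.
  apply: continuous_subspaceT => x.
  by apply: continuous_comp; [exact: cg|exact: norm_continuous].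
exists `|g c| => x; have [Mx|xM] := ltP M `|x|; first by rewrite g0// normr0.
by apply: Hc; rewrite in_itv/= -ler_norml.
Qed.

Lemma real_schwartz_smooth_outside g M : smooth g ->
  (forall x, M < `|x| -> g x = 0) -> real_schwartz g.
Proof.
move=> sg g0 n; split.
  exact: smooth_derivable (smooth_derive1n n sg).
move=> k; apply: (@continuous_outside_bounded _ M) => [x|x Mx].
  apply: cvgM; first exact: exprn_continuous.
  exact: smooth_continuous (smooth_derive1n n sg) x.
by rewrite (derive1n_outside n g0)// mulr0.
Qed.

End compactly_supported.

(** * Integrals over the real line *)

Section integration.
Context {R : realType}.
Local Notation mu := (@lebesgue_measure R).
Implicit Types (f g h F G : R -> R).

Lemma integrable_le f g : continuous f -> (forall x, `|f x| <= g x) ->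
  mu.-integrable setT (EFin \o g) -> mu.-integrable setT (EFin \o f).
Proof.
move=> cf fg; apply: le_integrable => //.
  apply/measurable_EFinP. exact: continuous_measurable_fun.
by move=> x _; rewrite /= lee_fin; apply: le_trans (fg x) (ler_norm _).
Qed.

Lemma integrable_norm f :
  mu.-integrable setT (EFin \o f) -> mu.-integrable setT (EFin \o (fun x => `|f x|)).
Proof. by move=> /integrable_abse; apply: eq_integrable. Qed.

Lemma integrableM_cst (c : R) f : mu.-integrable setT (EFin \o f) ->
  mu.-integrable setT (EFin \o (fun x => c * f x)).
Proof. by move=> /(integrableZl measurableT c); apply: eq_integrable. Qed.

Lemma integrableM_bounded f h (C : R) : continuous f -> continuous h ->
  (forall x, `|f x| <= C) -> mu.-integrable setT (EFin \o h) ->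
  mu.-integrable setT (EFin \o (fun x => f x * h x)).
Proof.
move=> cf ch fC ih; apply: (@integrable_le _ (fun x => C * `|h x|)).
- by move=> x; apply: cvgM; [exact: cf|exact: ch].
- by move=> x; rewrite normrM ler_wpM2r.
- exact/integrableM_cst/integrable_norm.
Qed.

Lemma integrable_outside g (M : R) : continuous g ->
  (forall x, M < `|x| -> g x = 0) -> mu.-integrable setT (EFin \o g).
Proof.
move=> cg g0.
have : mu.-integrable `[- M, M] (EFin \o g).
  apply: continuous_compact_integrable; first exact: segment_compact.
  exact: continuous_subspaceT.
move/integrable_mkcond => /(_ (measurable_itv _)); apply: eq_integrable => // x _.
rewrite /= patchE; case: ifPn => // /negP xM; rewrite g0// ltNge.
by apply: contra_notN xM; rewrite inE/= in_itv/= -ler_norml.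
Qed.

Lemma Rintegral_outside g (M : R) : (forall x, M < `|x| -> g x = 0) ->
  \int[mu]_x g x = \int[mu]_(x in `[- M, M]) g x.
Proof.
move=> g0; rewrite [RHS]Rintegral_mkcond; apply: eq_Rintegral => x _.
rewrite patchE; case: ifPn => // /negP xM; rewrite g0// ltNge.
by apply: contra_notN xM; rewrite inE/= in_itv/= -ler_norml.
Qed.

Lemma Rintegral_FTC F f (a b : R) : a < b -> continuous f ->
  (forall x, is_derive x (1 : R) F (f x)) ->
  \int[mu]_(x in `[a, b]) f x = F b - F a.
Proof.
move=> ab cf dF; rewrite /Rintegral (@continuous_FTC2 _ _ F)//.
- exact: continuous_subspaceT.
- have cF : continuous F.
    by move=> x; apply/differentiable_continuous/derivable1_diffP.
  split=> [x _|//|]; first by have [] := dF x.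
    exact/cvg_at_right_filter/cF.
  exact/cvg_at_left_filter/cF.
- by move=> x _; rewrite derive1E; have [_ ->] := dF x.
Qed.

(** Stated for extended integrals, without integrability, because it is what proves
    [integrable_affine]. *)
Lemma Rintegral_affine_ge0 (a b : R) G : 0 < a -> continuous G ->
  (forall x, 0 <= G x) ->
  (\int[mu]_x (G x)%:E = \int[mu]_x (a * G (a * x + b))%:E)%E.
Proof.
move=> a0 cG G0.
have dF (x : R) : is_derive x (1 : R) (fun x => a * x + b) a.
  apply: (@is_derive_eq _ _ _ ((a \*: @id R) + cst b)).
  by rewrite addr0 /GRing.scale/= mulr1.
have F'E : derive1 (fun x => a * x + b) = cst a.
  by apply/funext => x; rewrite derive1E; have [_ ->] := dF x.
rewrite (@increasing_ge0_integration_by_substitutionT _ (fun x => a * x + b))//.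
- by apply: eq_integral => x _; rewrite F'E mulrfctE/= mulrC.
- by move=> x y xy; rewrite ltrD2r ltr_pM2l.
- by rewrite F'E; exact: cst_continuous.
- by rewrite F'E; exact: is_cvg_cst.
- by rewrite F'E; exact: is_cvg_cst.
- apply/cvgrNyPle => A; near=> x.
  rewrite -lerBrDr mulrC -ler_pdivlMr//.
- apply/cvgryPge => A; near=> x.
  rewrite -lerBlDr mulrC -ler_pdivrMr//.
Unshelve. all: by end_near. Qed.

Lemma integrable_affine (a b : R) h : 0 < a -> continuous h ->
  mu.-integrable setT (EFin \o h) ->
  mu.-integrable setT (EFin \o (fun x => h (a * x + b))).
Proof.
move=> a0 ch ih.
have ca : continuous (fun x : R => a * x + b).
  by move=> x; apply: cvgD; [apply: cvgM; [exact: cvg_cst|exact: cvg_id]|exact: cvg_cst].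
have cha : continuous (fun x => h (a * x + b)).
  by move=> x; apply: (@continuous_comp _ _ _ (fun x : R => a * x + b)); [exact: ca|exact: ch].
have cn : continuous (fun x => `|h x|).
  by move=> x; apply: continuous_comp; [exact: ch|exact: (@norm_continuous R R)].
have cna : continuous (fun x => `|h (a * x + b)|).
  by move=> x; apply: continuous_comp; [exact: cha|exact: (@norm_continuous R R)].
have : mu.-integrable setT (EFin \o (fun x => a * `|h (a * x + b)|)).
  apply/integrableP; split.
    apply/measurable_EFinP; apply: continuous_measurable_fun => x.
    by apply: cvgM; [exact: cvg_cst|exact: cna].
  have /integrableP[_] := ih; apply: le_lt_trans.
  rewrite [leRHS](_ : _ = \int[mu]_x (`|h x|)%:E)%E; last first.
    by apply: eq_integral.
  rewrite (Rintegral_affine_ge0 b a0 cn)//.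
  rewrite le_eqVlt; apply/orP; left; apply/eqP/eq_integral => x _ /=.
  by rewrite normrM normr_id gtr0_norm.
move=> /(integrableM_cst a^-1); apply: integrable_le => // x.
by rewrite mulKf// gt_eqF.
Qed.

Lemma Rintegral_affine (a b : R) h : 0 < a -> continuous h ->
  mu.-integrable setT (EFin \o h) ->
  \int[mu]_x h (a * x + b) = a^-1 * \int[mu]_x h x.
Proof.
move=> a0 ch ih.
have cn : continuous (fun x => `|h x|).
  by move=> x; apply: continuous_comp; [exact: ch|exact: (@norm_continuous R R)].
have ge0 G : continuous G -> (forall x, 0 <= G x) ->
    mu.-integrable setT (EFin \o G) ->
    \int[mu]_x G x = a * \int[mu]_x G (a * x + b).
  move=> cG G0 iG; rewrite -RintegralZl//; last exact: integrable_affine.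
  by rewrite /Rintegral (Rintegral_affine_ge0 b a0 cG).
have ihn := integrable_norm ih.
have cs : continuous (fun x => h x + `|h x|).
  by move=> x; apply: cvgD; [exact: ch|exact: cn].
have ihs : mu.-integrable setT (EFin \o (fun x => h x + `|h x|)).
  by have := integrableD measurableT ih ihn; apply: eq_integrable.
(* Both terms are continuous and nonnegative, so the substitution for nonnegative functions applies
   to each. *)
have -> : \int[mu]_x h x = \int[mu]_x (h x + `|h x|) - \int[mu]_x `|h x|.
  by rewrite -RintegralB//; apply: eq_Rintegral => x _; rewrite addrK.
rewrite (ge0 _ cs) ?(ge0 _ cn)//; last first.
  by move=> x; have := ler_norm (- h x); rewrite normrN; lra.
rewrite -mulrBr mulKf ?gt_eqF// -RintegralB//.
- by apply: eq_Rintegral => x _; rewrite addrK.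
- exact: (integrable_affine b a0 cs).
- exact: (integrable_affine b a0 cn).
Qed.

Lemma integrable_oneDsqrV :
  mu.-integrable setT (EFin \o (fun x : R => (oneDsqr x)^-1)).
Proof.
apply/integrableP; split.
  apply/measurable_EFinP; apply: continuous_measurable_fun.
  exact: continuous_oneDsqrV.
under eq_integral => x _ do rewrite /= ger0_norm ?invr_ge0//.
rewrite ge0_symfun_integralT//; last 2 first.
- exact: continuous_oneDsqrV.
- by move=> x; rewrite /= /oneDsqr sqrrN.
by rewrite -set_itvcy integral0y_oneDsqr -EFinM ltry.
Qed.

End integration.

(** * The cosine transform *)

Section cosine_transform.
Context {R : realType}.
Local Notation mu := (@lebesgue_measure R).
Implicit Types (f g h : R -> R) (b t x : R).

Lemma dominated_cvg_Rintegral (f_ : (R -> R)^nat) f g :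
  (forall n, continuous (f_ n)) -> continuous f ->
  (forall x, f_ n x @[n --> \oo] --> f x) ->
  mu.-integrable setT (EFin \o g) -> (forall n x, `|f_ n x| <= g x) ->
  \int[mu]_x f_ n x @[n --> \oo] --> \int[mu]_x f x.
Proof.
move=> cf_ cf f_f ig f_g; apply: fine_cvg.
have fg x : `|f x| <= g x.
  have /cvg_lim <-// : (fun n => `|f_ n x|) @ \oo --> `|f x|.
    by apply: cvg_norm; exact: f_f.
  apply: limr_le; last by apply: nearW => n.
  by apply: is_cvg_norm; apply/cvg_ex; exists (f x); exact: f_f.
have if_ : mu.-integrable setT (EFin \o f) by exact: integrable_le ig.
rewrite fineK; last exact: integrable_fin_num.
apply: (@dominated_cvg _ _ _ mu setT measurableT (fun n x => (f_ n x)%:E)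
  (EFin \o f) (EFin \o g)) => //.
- by move=> n; apply/measurable_EFinP; apply: continuous_measurable_fun.
- by move=> x _; apply: cvg_EFin; [exact: nearW|exact: f_f].
- by move=> n x _; rewrite /= lee_fin.
Qed.

Lemma continuousM_fun f g : continuous f -> continuous g ->
  continuous (fun x => f x * g x).
Proof. by move=> cf cg x; apply: cvgM; [exact: cf|exact: cg]. Qed.

Lemma continuous_mull b : continuous (fun x => b * x).
Proof. by apply: continuousM_fun => x; [exact: cvg_cst|exact: cvg_id]. Qed.

Lemma continuous_norm_fun f : continuous f -> continuous (fun x => `|f x|).
Proof.
by move=> cf x; apply: continuous_comp; [exact: cf|exact: (@norm_continuous R R)].
Qed.

Lemma continuous_comp_fun f g : continuous f -> continuous g ->
  continuous (fun x => f (g x)).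
Proof.
by move=> cf cg x; apply: (@continuous_comp _ _ _ g f); [exact: cg|exact: cf].
Qed.

Lemma continuousB_fun f g : continuous f -> continuous g ->
  continuous (fun x => f x - g x).
Proof. by move=> cf cg x; apply: cvgB; [exact: cf|exact: cg]. Qed.

Lemma continuous_cosM b : continuous (fun x => cos (b * x)).
Proof.
by apply: continuous_comp_fun; [exact: continuous_cos|exact: continuous_mull].
Qed.

Lemma is_derive_cosM b x :
  is_derive x (1 : R) (fun x => cos (b * x)) (- (b * sin (b * x))).
Proof.
apply: (@is_derive_eq _ _ _ (cos \o (b \*: @id R))).
by rewrite /GRing.scale/=; ring.
Qed.

Lemma is_derive_sinM b x :
  is_derive x (1 : R) (fun x => sin (b * x)) (b * cos (b * x)).
Proof.
apply: (@is_derive_eq _ _ _ (sin \o (b \*: @id R))).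
by rewrite /GRing.scale/=; ring.
Qed.

(** The real part of the Fourier transform of a real function. *)
Definition cosint g t : R := \int[mu]_x (cos (2 * pi * x * t) * g x).

Lemma cosintE g t : cosint g t = \int[mu]_x (cos (2 * pi * t * x) * g x).
Proof. by apply: eq_Rintegral => x _; congr (cos _ * _); ring. Qed.

Lemma norm_cos_le1 x : `|cos x : R| <= 1.
Proof. by rewrite ler_norml cos_geN1 cos_le1. Qed.

Lemma integrable_cosM b g : continuous g -> mu.-integrable setT (EFin \o g) ->
  mu.-integrable setT (EFin \o (fun x => cos (b * x) * g x)).
Proof.
move=> cg ig; apply: (@integrableM_bounded _ _ _ 1) => //.
- exact: continuous_cosM.
- by move=> x; exact: norm_cos_le1.
Qed.

Lemma le_norm_Rintegral_cosM b g : continuous g ->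
  mu.-integrable setT (EFin \o g) ->
  `|\int[mu]_x (cos (b * x) * g x)| <= \int[mu]_x `|g x|.
Proof.
move=> cg ig; apply: (le_trans (le_normr_Rintegral _ _)) => //.
  exact: integrable_cosM.
apply: le_Rintegral => //.
- exact/integrable_norm/integrable_cosM.
- exact: integrable_norm.
- by move=> x _; rewrite normrM ler_piMl// norm_cos_le1.
Qed.

Lemma cosint_continuous g : continuous g -> mu.-integrable setT (EFin \o g) ->
  continuous (cosint g).
Proof.
move=> cg ig t.
have := @continuity_under_integral R _ _ mu
  (fun t x => cos (2 * pi * x * t) * g x) setT measurableT (t - 1) (t + 1).
move/(_ _ _ (fun x => `|g x|) _ _ t); apply.
- move=> u _; rewrite (_ : (fun _ => _) = fun x => cos (2 * pi * u * x) * g x).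
    exact: integrable_cosM.
  by apply/funext => x; congr (cos _ * _); ring.
- apply: aeW => x _ u _; apply: cvgM; last exact: cvg_cst.
  exact: continuous_cosM.
- exact: integrable_norm.
- move=> u _; apply: aeW => x _.
  by rewrite normrM ler_piMl// norm_cos_le1.
- by rewrite inE/= in_itv/=; lra.
Qed.

Lemma cosint_scale g (r t : R) : 0 < r -> continuous g ->
  mu.-integrable setT (EFin \o g) ->
  cosint (fun x => g (r^-1 * x)) t = r * cosint g (r * t).
Proof.
move=> r0 cg ig; rewrite !cosintE.
pose h x := cos (2 * pi * (r * t) * x) * g x.
transitivity (\int[mu]_x h (r^-1 * x + 0)).
  apply: eq_Rintegral => x _; rewrite addr0 /h; congr (cos _ * _).
  by field; rewrite gt_eqF.
rewrite Rintegral_affine ?invr_gt0// ?invrK//.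
- by apply: continuousM_fun => //; exact: continuous_cosM.
- exact: integrable_cosM.
Qed.

Lemma cosintB g h t : continuous g -> continuous h ->
  mu.-integrable setT (EFin \o g) -> mu.-integrable setT (EFin \o h) ->
  cosint (fun x => g x - h x) t = cosint g t - cosint h t.
Proof.
move=> cg ch ig ih; rewrite !cosintE -RintegralB//; try exact: integrable_cosM.
by apply: eq_Rintegral => x _; rewrite mulrBr.
Qed.

(** Two integrations by parts at once: the derivative of
    [g' cos (b x) + b g sin (b x)] is [g'' cos (b x) + b^2 g cos (b x)]. *)
Lemma cosint_decay g (M : R) : smooth g -> (forall x, M < `|x| -> g x = 0) ->
  exists C, forall t, `|cosint g t| <= C * (oneDsqr t)^-1.
Proof.
move=> sg g0.
have sg' := smooth_derive1 sg; have sg'' := smooth_derive1 sg'.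
have g'0 : forall x, M < `|x| -> derive1 g x = 0 := derive1n_outside 1 g0.
have g''0 : forall x, M < `|x| -> derive1 (derive1 g) x = 0 :=
  derive1n_outside 2 g0.
have cg := smooth_continuous sg; have cg'' := smooth_continuous sg''.
have ig := integrable_outside cg g0; have ig'' := integrable_outside cg'' g''0.
(* The first integral bounds the transform, the second bounds t^2 times the transform; their sum
   bounds (1 + t^2) times it. *)
exists (\int[mu]_x `|g x| + \int[mu]_x `|derive1 (derive1 g) x|) => t.
rewrite ler_pdivlMr ?(lt_le_trans _ (oneDsqr_ge1 _))//.
pose b := 2 * pi * t.
have parts : b ^+ 2 * cosint g t = - \int[mu]_x (cos (b * x) * derive1 (derive1 g) x).
  (* Positive whatever the sign of [M], and strictly beyond it, so that the boundary terms at N and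
     -N vanish. *)
  pose N : R := `|M| + 1.
  have MN : M < N by rewrite /N; have := ler_norm M; lra.
  have N0 : 0 < N by rewrite /N ltr_wpDl.
  apply/eqP; rewrite -subr_eq0 opprK cosintE -/b.
  rewrite -RintegralZl//; last exact: integrable_cosM.
  rewrite -RintegralD//; last 2 first.
  - exact/integrableM_cst/integrable_cosM.
  - exact: integrable_cosM.
  rewrite (@Rintegral_outside _ _ N); last first.
    move=> x Nx; have Mx := lt_trans MN Nx.
    by rewrite (g0 _ Mx) (g''0 _ Mx) !mulr0 addr0.
  apply/eqP; pose F (x : R) : R := derive1 g x * cos (b * x) + b * (g x * sin (b * x)).
  transitivity (F N - F (- N)); last first.
    have Nout (s : R) : `|s| = N -> M < `|s| by move=> ->.
    have NN := Nout N (gtr0_norm N0).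
    have NN' : M < `|- N| by rewrite normrN.
    by rewrite /F (g0 _ NN) (g'0 _ NN) (g0 _ NN') (g'0 _ NN'); ring.
  apply: Rintegral_FTC; first by lra.
    move=> x; apply: cvgD.
      by apply: cvgM; [exact: cvg_cst|apply: continuousM_fun => //; exact: continuous_cosM].
    by apply: continuousM_fun => //; exact: continuous_cosM.
  move=> x.
  have dg : is_derive x (1 : R) g (derive1 g x).
    by rewrite derive1E; apply/derivableP; exact: smooth_derivable.
  have dg' : is_derive x (1 : R) (derive1 g) (derive1 (derive1 g) x).
    by rewrite [derive1 (derive1 g) x]derive1E; apply/derivableP; exact: smooth_derivable.
  have dc := is_derive_cosM b x; have ds := is_derive_sinM b x.
  have := is_deriveD (is_deriveM dg' dc) (is_deriveZ b (is_deriveM dg ds)).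
  by move/is_derive_eq; apply; rewrite /GRing.scale/=; ring.
have b2 : t ^+ 2 <= b ^+ 2.
  have p1 : 1 <= pi :> R by have := pi_ge2 R; lra.
  rewrite /b exprMn ler_peMl ?sqr_ge0// -[leLHS](expr1n _ 2) lerXn2r ?nnegrE//; lra.
have B1 : `|cosint g t| <= \int[mu]_x `|g x|.
  by rewrite cosintE; exact: le_norm_Rintegral_cosM.
have B2 : t ^+ 2 * `|cosint g t| <= \int[mu]_x `|derive1 (derive1 g) x|.
  apply: (@le_trans _ _ (b ^+ 2 * `|cosint g t|)); first exact: ler_wpM2r.
  rewrite -[b ^+ 2]ger0_norm ?sqr_ge0// -normrM parts normrN.
  exact: le_norm_Rintegral_cosM.
by rewrite /oneDsqr mulrDr mulr1 [X in _ + X]mulrC lerD.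
Qed.

End cosine_transform.

(** * The transform of the plateau *)

Section fourier_inversion_constant.
Context {R : realType}.
Local Notation mu := (@lebesgue_measure R).
Implicit Types (f g h : R -> R) (b t x : R).

(** Both sides integrate g(t) h(x) cos(2 pi t x) over the plane, and the cosine is symmetric in t
    and x. *)
Lemma cosint_Fubini g h (M N : R) : continuous g -> continuous h ->
  (forall x, M < `|x| -> g x = 0) -> (forall x, N < `|x| -> h x = 0) ->
  \int[mu]_t (g t * cosint h t) = \int[mu]_x (h x * cosint g x).
Proof.
move=> cg ch g0 h0.
have ig := integrable_outside cg g0; have ih := integrable_outside ch h0.
pose F (z : R * R) := (g z.1 * h z.2 * cos (2 * pi * z.1 * z.2)).
have mF : measurable_fun setT (EFin \o F).
  apply/measurable_EFinP.
  have m1 : measurable_fun [set: R * R] (fun z => g z.1).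
    by apply: measurableT_comp => //; exact: continuous_measurable_fun.
  have m2 : measurable_fun [set: R * R] (fun z => h z.2).
    by apply: measurableT_comp => //; exact: continuous_measurable_fun.
  apply: measurable_funM; first exact: measurable_funM.
  apply: measurableT_comp; first by apply: continuous_measurable_fun; exact: continuous_cos.
  by apply: measurable_funM => //; apply: measurable_funM.
have finh := integrable_fin_num measurableT ih.
have ing t : mu.-integrable setT (EFin \o (fun x => F (t, x))).
  have := integrableM_cst (g t) (integrable_cosM (2 * pi * t) ch ih).
  by apply: eq_integrable => // x _ /=; congr EFin; rewrite /F/=; ring.
have inh x : mu.-integrable setT (EFin \o (fun t => F (t, x))).
  have := integrableM_cst (h x) (integrable_cosM (2 * pi * x) cg ig).
  apply: eq_integrable => // t _ /=; congr EFin; rewrite /F/=.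
  by rewrite (_ : 2 * pi * t * x = 2 * pi * x * t); ring.
have iF : (mu \x mu)%E.-integrable setT (EFin \o F).
  (* By Tonelli it is enough to bound the iterated integral of the absolute value, here by the
     product of the L^1 norms of [g] and [h]. *)
  apply/integrable12ltyP => //.
  apply: (@le_lt_trans _ _ (\int[mu]_t (`|g t| * \int[mu]_x `|h x|)%:E)%E).
    apply: ge0_le_integral => //.
    - by move=> t _; apply: integral_ge0.
    - apply: (@measurable_fun_fubini_tonelli_F _ _ _ _ _ mu (fun z => `|(EFin \o F) z|)%E) => //.
      exact: measurableT_comp.
    - apply/measurable_EFinP; apply: continuous_measurable_fun.
      apply: continuousM_fun; last by move=> x; exact: cvg_cst.
      exact: continuous_norm_fun.
    - move=> t _.
      apply: (@le_trans _ _ (\int[mu]_x (`|g t| * `|h x|)%:E)%E).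
        apply: ge0_le_integral => //.
        + apply/measurable_EFinP; apply: measurableT_comp => //.
          by apply/measurable_EFinP; have /integrableP[] := ing t.
        + apply/measurable_EFinP; apply: continuous_measurable_fun.
          apply: continuousM_fun; last exact: continuous_norm_fun.
          by move=> x; exact: cvg_cst.
        + move=> x _; rewrite lee_fin /F/= !normrM ler_piMr//.
          exact: norm_cos_le1.
      rewrite -RintegralZl//; last exact: integrable_norm.
      rewrite /Rintegral fineK//.
      exact/integrable_fin_num/integrableM_cst/integrable_norm.
  have /integrable_norm/(integrableM_cst (\int[mu]_x `|h x|))/integrableP[_] := ig.
  apply: le_lt_trans; rewrite le_eqVlt; apply/orP; left; apply/eqP.
  apply: eq_integral => x _ /=; congr EFin.
  rewrite [RHS]normrM normr_id [X in _ = X * _]ger0_norm; last exact: Rintegral_ge0.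
  by rewrite mulrC.
have := Fubini iF => FF.
rewrite /Rintegral; transitivity (fine (\int[mu]_t \int[mu]_x (F (t, x))%:E)%E).
  congr fine; apply: eq_integral => t _.
  rewrite cosintE -RintegralZl//; last exact: integrable_cosM.
  rewrite /Rintegral fineK; last exact/integrable_fin_num/integrableM_cst/integrable_cosM.
  by apply: eq_integral => x _; congr EFin; rewrite /F/=; ring.
rewrite FF; congr fine; apply: eq_integral => x _.
rewrite /cosint -RintegralZl//; last first.
  have := integrable_cosM (2 * pi * x) cg ig.
  apply: eq_integrable => // t _; congr EFin; rewrite /=.
  by rewrite (_ : 2 * pi * t * x = 2 * pi * x * t)//; ring.
rewrite /Rintegral fineK.
  by apply: eq_integral => t _; congr EFin; rewrite /F/=; ring.
have := integrable_fin_num measurableT (inh x); congr (is_true (_ \is a fin_num)).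
by apply: eq_integral => t _; congr EFin; rewrite /F/=; ring.
Qed.

(** Chosen as damping factor because its transform is the Fejer kernel, which is nonnegative, while
    the tent itself lies between 0 and 1 and equals 1 at 0. *)
Definition tent x : R := Num.max 0 (1 - `|x|).

Lemma tent_continuous : continuous tent.
Proof.
move=> x; apply: (@continuous_max _ _ (cst 0) (fun x => 1 - `|x|)).
  exact: cvg_cst.
by apply: cvgB; [exact: cvg_cst|exact: (@norm_continuous R R)].
Qed.

Lemma tent_ge0 x : 0 <= tent x.
Proof. by rewrite /tent le_max lexx. Qed.

Lemma tent_le1 x : tent x <= 1.
Proof. by rewrite /tent ge_max ler01/= gerBl. Qed.

Lemma tent0 : tent 0 = 1.
Proof. by rewrite /tent normr0 subr0; apply/max_idPr. Qed.

Lemma tent_outer x : 1 < `|x| -> tent x = 0.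
Proof. by move=> x1; apply/max_idPl; rewrite subr_le0 ltW. Qed.

Lemma tent_inner x : `|x| <= 1 -> tent x = 1 - `|x|.
Proof. by move=> x1; apply/max_idPr; rewrite subr_ge0. Qed.

Lemma integrable_tent : mu.-integrable setT (EFin \o tent).
Proof. exact: (integrable_outside tent_continuous tent_outer). Qed.

Lemma Rintegral_split g (a b c : R) : a < b -> b < c -> continuous g ->
  \int[mu]_(x in `[a, c]) g x =
  \int[mu]_(x in `[a, b]) g x + \int[mu]_(x in `[b, c]) g x.
Proof.
move=> ab bc cg.
have ii (u v : R) : mu.-integrable `[u, v] (EFin \o g).
  apply: continuous_compact_integrable; first exact: segment_compact.
  exact: continuous_subspaceT.
rewrite -(@Rintegral_itv_obnd_cbnd _ b); last first.
  apply: (integrableS _ _ _ (ii b c)) => //.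
  by apply: subset_itv; rewrite bnd_simp.
rewrite -(@Rintegral_itvB _ _ (BLeft a) (BRight c) b)//.
- by rewrite addrC subrK.
- by rewrite bnd_simp ltW.
- by rewrite bnd_simp ltW.
Qed.

(** Kept apart because the closed form behind [cosint_tent_ge0] divides by t^2. *)
Lemma cosint_tent0 : cosint tent 0 = 1.
Proof.
have -> : cosint tent 0 = \int[mu]_x tent x.
  by apply: eq_Rintegral => x _; rewrite mulr0 cos0 mul1r.
rewrite (@Rintegral_outside _ _ 1); last exact: tent_outer.
rewrite (@Rintegral_split _ _ 0) ?ltrN10//; last exact: tent_continuous.
have -> : \int[mu]_(x in `[-1, 0]) tent x = \int[mu]_(x in `[-1, 0]) (1 + 1 * x).
  apply: eq_Rintegral => x; rewrite mul1r inE/= in_itv/= => /andP[x1 x0].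
  by rewrite tent_inner ler0_norm//; [rewrite opprK|lra].
have -> : \int[mu]_(x in `[0, 1]) tent x = \int[mu]_(x in `[0, 1]) (1 + -1 * x).
  apply: eq_Rintegral => x; rewrite mulN1r inE/= in_itv/= => /andP[x0 x1].
  by rewrite tent_inner ger0_norm.
(* The slope s is 1 on the left half of the tent and -1 on the right half; one antiderivative serves
   both. *)
have H (s : R) x : is_derive x (1 : R) (fun x => x + s / 2 * x * x) (1 + s * x).
  have d1 := @is_derive_id R R x 1.
  have := is_deriveD d1 (is_deriveM (is_deriveZ (s / 2) d1) d1).
  by move/is_derive_eq; apply; rewrite /= /GRing.scale/=; field.
have L (s a b : R) : a < b -> \int[mu]_(x in `[a, b]) (1 + s * x) =
    (b + s / 2 * b * b) - (a + s / 2 * a * a).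
  move=> ab; apply: (@Rintegral_FTC _ (fun x => x + s / 2 * x * x)) => // x.
  by apply: cvgD; [exact: cvg_cst|exact: continuous_mull].
by rewrite !L ?ltrN10//; field.
Qed.

(** With b = 2 pi t, each half of the tent contributes (1 - cos b) / b^2, as an explicit
    antiderivative shows. *)
Lemma cosint_tent_ge0 t : 0 <= cosint tent t.
Proof.
have [->|t0] := eqVneq t 0; first by rewrite cosint_tent0.
pose b := 2 * pi * t.
have b0 : b != 0.
  by rewrite /b !mulf_neq0// ?gt_eqF// pi_gt0.
rewrite cosintE -/b (@Rintegral_outside _ _ 1); last first.
  by move=> x x1; rewrite tent_outer// mulr0.
have cc : continuous (fun x => cos (b * x) * tent x).
  by apply: continuousM_fun; [exact: continuous_cosM|exact: tent_continuous].
rewrite (@Rintegral_split _ _ 0) ?ltrN10//.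
have H (s : R) x : is_derive x (1 : R)
    (fun x => b^-1 * ((1 + s * x) * sin (b * x)) + s * b^-1 ^+ 2 * cos (b * x))
    (cos (b * x) * (1 + s * x)).
  have dl : is_derive x (1 : R) (fun x => 1 + s * x) s.
    apply: (@is_derive_eq _ _ _ (cst 1 + (s \*: @id R))).
    by rewrite /GRing.scale/=; ring.
  have dc := is_derive_cosM b x; have ds := is_derive_sinM b x.
  have := is_deriveD (is_deriveZ b^-1 (is_deriveM dl ds))
                     (is_deriveZ (s * b^-1 ^+ 2) dc).
  by move/is_derive_eq; apply; rewrite /GRing.scale/=; field.
have L (s u v : R) : u < v -> \int[mu]_(x in `[u, v]) (cos (b * x) * (1 + s * x)) =
    (b^-1 * ((1 + s * v) * sin (b * v)) + s * b^-1 ^+ 2 * cos (b * v)) -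
    (b^-1 * ((1 + s * u) * sin (b * u)) + s * b^-1 ^+ 2 * cos (b * u)).
  move=> uv; apply: (@Rintegral_FTC _
    (fun x => b^-1 * ((1 + s * x) * sin (b * x)) + s * b^-1 ^+ 2 * cos (b * x))) => // x.
  apply: cvgM; first exact: continuous_cosM.
  by apply: cvgD; [exact: cvg_cst|exact: continuous_mull].
have -> : \int[mu]_(x in `[-1, 0]) (cos (b * x) * tent x) = b^-1 ^+ 2 * (1 - cos b).
  transitivity (\int[mu]_(x in `[-1, 0]) (cos (b * x) * (1 + 1 * x))).
    apply: eq_Rintegral => x; rewrite inE/= in_itv/= => /andP[x1 x0].
    by rewrite tent_inner ler0_norm//; [rewrite opprK mul1r|lra].
  by rewrite L ?ltrN10// !mulr0 cos0 sin0 !mulrN1 cosN; ring.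
have -> : \int[mu]_(x in `[0, 1]) (cos (b * x) * tent x) = b^-1 ^+ 2 * (1 - cos b).
  transitivity (\int[mu]_(x in `[0, 1]) (cos (b * x) * (1 + -1 * x))).
    apply: eq_Rintegral => x; rewrite inE/= in_itv/= => /andP[x0 x1].
    by rewrite tent_inner ger0_norm// mulN1r.
  by rewrite L// !mulr0 cos0 sin0 !mulr1; ring.
by rewrite addr_ge0// mulr_ge0 ?sqr_ge0// subr_ge0 cos_le1.
Qed.

Lemma Rintegral_tent : \int[mu]_x tent x = 1.
Proof.
rewrite -cosint_tent0; apply: eq_Rintegral => x _.
by rewrite mulr0 cos0 mul1r.
Qed.

(** By continuity a tent of height g(0) / 2 over a small interval around 0 fits under the graph. *)
Lemma Rintegral_gt0 g : continuous g -> (forall x, 0 <= g x) -> 0 < g 0 ->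
  mu.-integrable setT (EFin \o g) -> 0 < \int[mu]_x g x.
Proof.
move=> cg g_ge0 g0 ig.
have /cvgrPdist_lt/(_ (g 0 / 2)) := cg 0.
rewrite divr_gt0// => /(_ isT) /nbhs_ballP[d /= d0 Hd].
have tg x : g 0 / 2 * tent (d^-1 * x + 0) <= g x.
  rewrite addr0; have [dx|xd] := leP d `|x|.
    suff -> : tent (d^-1 * x) = 0 by rewrite mulr0.
    apply/max_idPl; rewrite subr_le0 normrM gtr0_norm ?invr_gt0//.
    by rewrite ler_pdivlMl// mulr1.
  have := Hd x; rewrite /ball/= sub0r normrN => /(_ xd).
  rewrite ltr_norml => /andP[_ h]; apply: (@le_trans _ _ (g 0 / 2)).
    by rewrite ler_piMr ?tent_le1// ltW// divr_gt0.
  lra.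
have dV : 0 < d^-1 by rewrite invr_gt0.
apply: (@lt_le_trans _ _ (\int[mu]_x (g 0 / 2 * tent (d^-1 * x + 0)))).
  have := integrable_affine 0 dV tent_continuous integrable_tent => it.
  rewrite RintegralZl// (Rintegral_affine 0 dV tent_continuous integrable_tent).
  by rewrite Rintegral_tent invrK mulr1 mulr_gt0// divr_gt0.
apply: le_Rintegral => //.
apply: integrableM_cst.
exact: (integrable_affine 0 dV tent_continuous integrable_tent).
Qed.

Definition plateau_hat : R -> R := cosint plateau.

Lemma plateau_out x : 3 < `|x| -> plateau x = 0.
Proof. by move=> /ltW; exact: plateau_outer. Qed.

Lemma plateau_continuous : continuous (@plateau R).
Proof. exact: smooth_continuous smooth_plateau. Qed.

Lemma integrable_plateau : mu.-integrable setT (EFin \o plateau).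
Proof. exact: integrable_outside plateau_continuous plateau_out. Qed.

Lemma plateau_hat_continuous : continuous plateau_hat.
Proof. exact: cosint_continuous plateau_continuous integrable_plateau. Qed.

Lemma plateau_hat_decay : exists C, forall t, `|plateau_hat t| <= C * (oneDsqr t)^-1.
Proof. exact: cosint_decay smooth_plateau plateau_out. Qed.

Lemma integrable_plateau_hat : mu.-integrable setT (EFin \o plateau_hat).
Proof.
have [C HC] := plateau_hat_decay; apply: integrable_le plateau_hat_continuous HC _.
exact/integrableM_cst/integrable_oneDsqrV.
Qed.

(** Damp the integral by [tent (t / r)] and move it to the plateau by Fubini: as
    the transform of the tent is nonnegative, the damped integrals are bounded
    below by a positive constant that does not depend on r. *)
Lemma Rintegral_plateau_hat_gt0 : 0 < \int[mu]_t plateau_hat t.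
Proof.
pose p x := tent x * cosint tent x.
have ct := cosint_continuous tent_continuous integrable_tent.
have cp : continuous p by apply: continuousM_fun => //; exact: tent_continuous.
have ip : mu.-integrable setT (EFin \o p).
  apply: (integrable_outside cp (M := 1)) => x x1.
  by rewrite /p tent_outer// mul0r.
have dp : 0 < \int[mu]_x p x.
  apply: Rintegral_gt0 => //.
    by move=> x; rewrite mulr_ge0 ?tent_ge0 ?cosint_tent_ge0.
  by rewrite /p tent0 cosint_tent0 mulr1.
have cs (r : R) : continuous (fun x => tent (r * x)).
  by apply: continuous_comp_fun; [exact: tent_continuous|exact: continuous_mull].
have cb (r : R) : continuous (fun x => plateau (r * x)).
  by apply: continuous_comp_fun; [exact: plateau_continuous|exact: continuous_mull].
apply: (@lt_le_trans _ _ (plateau 0 * \int[mu]_x p x)); first by rewrite mulr_gt0// plateau0_gt0.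
have lim : \int[mu]_t (tent (n.+1%:R^-1 * t) * plateau_hat t) @[n --> \oo] --> \int[mu]_t plateau_hat t.
  apply: (@dominated_cvg_Rintegral _ _ _ (fun t => `|plateau_hat t|)).
  - by move=> n; apply: continuousM_fun => //; exact: plateau_hat_continuous.
  - exact: plateau_hat_continuous.
  - move=> t; suff : tent (n.+1%:R^-1 * t) * plateau_hat t @[n --> \oo] -->
        tent (0 * t) * plateau_hat t by rewrite mul0r tent0 mul1r.
    apply: cvgM; last exact: cvg_cst.
    apply: continuous_cvg; first exact: tent_continuous.
    by apply: cvgM; [exact: (@cvg_harmonic R)|exact: cvg_cst].
  - exact: integrable_norm integrable_plateau_hat.
  - move=> n x; rewrite normrM ler_piMl// ger0_norm ?tent_ge0//.
    exact: tent_le1.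
rewrite -(cvg_lim _ lim)//; apply: limr_ge; first by apply/cvg_ex; eexists; exact: lim.
apply: nearW => n; pose r : R := n.+1%:R.
have r0 : 0 < r by rewrite ltr0n.
have rV0 : 0 < r^-1 by rewrite invr_gt0.
have r1 : 1 <= r by rewrite ler1n.
have out x : r < `|x| -> tent (r^-1 * x) = 0.
  by move=> rx; rewrite tent_outer// normrM gtr0_norm// ltr_pdivlMl// mulr1.
rewrite (cosint_Fubini (cs _) plateau_continuous out plateau_out).
(* The transform of the stretched tent is r times the transform of the tent at r x; a substitution
   moves the dilation onto the plateau. *)
have -> : \int[mu]_x (plateau x * cosint (fun x => tent (r^-1 * x)) x) =
    \int[mu]_x (plateau (r^-1 * x) * cosint tent x).
  pose h x := plateau (r^-1 * x) * cosint tent x.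
  have ch : continuous h by apply: continuousM_fun => //; exact: cb.
  have hout x : r * 3 < `|x| -> h x = 0.
    move=> rx; rewrite /h plateau_out ?mul0r// normrM gtr0_norm//.
    by rewrite ltr_pdivlMl.
  have ih := integrable_outside ch hout.
  transitivity (r * \int[mu]_x h (r * x + 0)).
    have ihr := integrable_affine 0 r0 ch ih.
    rewrite -RintegralZl//; apply: eq_Rintegral => x _.
    rewrite (cosint_scale _ r0 tent_continuous integrable_tent).
    by rewrite /h addr0 mulKf ?gt_eqF//; ring.
  by rewrite Rintegral_affine// mulrA mulfV ?gt_eqF// mul1r.
rewrite -RintegralZl//; apply: le_Rintegral => //.
- exact: integrableM_cst.
- apply: (integrable_outside (M := r * 3)) => [|x rx].
    by apply: continuousM_fun => //; exact: cb.
  rewrite plateau_out ?mul0r// normrM gtr0_norm//.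
  by rewrite ltr_pdivlMl.
(* On [-1, 1] the stretched plateau equals [plateau 0] and the tent is at most 1; elsewhere the tent
   vanishes. *)
- move=> x _; rewrite /p mulrA ler_wpM2r ?cosint_tent_ge0//.
  have [x1|x1] := ltP 1 `|x|; first by rewrite tent_outer// mulr0 plateau_ge0.
  rewrite plateau_inner ?ler_piMr ?tent_le1 ?plateau_ge0//.
  rewrite normrM gtr0_norm// ler_pdivrMl// (le_trans x1)//; lra.
Qed.

End fourier_inversion_constant.

(** * Spectra *)

Section spectra.
Context {R : realType}.
Local Notation mu := (@lebesgue_measure R).
Implicit Types (f g h F : R -> R) (t x : R).

Lemma schwartz_real g : real_schwartz g -> schwartz (fun x => Complex (g x) 0).
Proof.
move=> sg; split => //=.
by apply: (@real_schwartz_smooth_outside _ _ 0) => //; exact: smooth_cst.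
Qed.

(** For real functions the real part of the exponential kernel is a cosine; this extracts one real
    integral from a complex pairing. *)
Lemma Re_fourier_pairing f g :
  complex.Re (fourier_pairing (fun t => Complex (f t) 0) (fun x => Complex (g x) 0))
  = \int[mu]_t (f t * cosint g t).
Proof.
rewrite /fourier_pairing /cintegral /=; apply: eq_Rintegral => t _.
rewrite /fourier /cintegral /= mul0r subr0; congr (_ * _).
by apply: eq_Rintegral => x _ /=; rewrite cosN mulr0 subr0.
Qed.

(** Vanishing near every point of [I] is the pointwise form of a closed support disjoint from
    [I]. *)
Lemma spectrum_in_cosint (I : set R) f g (M : R) :
  spectrum_in I (fun t => Complex (f t) 0) -> smooth g ->
  (forall x, M < `|x| -> g x = 0) ->
  (forall x, I x -> \forall y \near x, g y = 0) ->
  \int[mu]_t (f t * cosint g t) = 0.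
Proof.
move=> sf sg g0 gI; rewrite -Re_fourier_pairing sf//.
  exact/schwartz_real/(real_schwartz_smooth_outside sg g0).
rewrite -subset0 => x [/(_ _ (gI x _)) + Ix] => /(_ Ix) [y [/= + gy]].
by rewrite gy eqxx.
Qed.

(** After substitution the dilation sits on the signal as F(t / r), which tends to F(0) as r grows,
    while the integral does not depend on r. *)
Lemma spectrum_in_reproducing F (C : R) : continuous F -> (forall x, `|F x| <= C) ->
  spectrum_in `[-1, 1] (fun t => Complex (F t) 0) ->
  (\int[mu]_t plateau_hat t) * F 0 = \int[mu]_t (F t * plateau_hat t).
Proof.
move=> cF FC sF.
have ck := @plateau_hat_continuous R; have ik := @integrable_plateau_hat R.
have cs f (r : R) : continuous f -> continuous (fun x => f (r * x)).
  by move=> cf; apply: continuous_comp_fun => //; exact: continuous_mull.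
have step n : \int[mu]_t (F (n.+1%:R^-1 * t) * plateau_hat t) = \int[mu]_t (F t * plateau_hat t).
  pose r : R := n.+1%:R; have r0 : 0 < r by rewrite ltr0n.
  have rV0 : 0 < r^-1 by rewrite invr_gt0.
  have r1 : 1 <= r by rewrite ler1n.
  have cp := cs _ r^-1 (@plateau_continuous R).
  have pout x : r * 3 < `|x| -> plateau (r^-1 * x) = 0.
    by move=> rx; rewrite plateau_out// normrM gtr0_norm// ltr_pdivlMl.
  have := @spectrum_in_cosint _ _ (fun x => plateau (r^-1 * x) - plateau x) (r * 3) sF.
  have sm : smooth (fun x : R => plateau (r^-1 * x) - plateau x).
    apply: smoothB; last exact: smooth_plateau.
    apply: (@smooth_comp _ plateau (fun x => r^-1 * x)); first exact: smooth_plateau.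
    exact/smoothZ/smooth_id.
  move=> /(_ sm) H.
  have {H} : \int[mu]_t (F t * cosint (fun x => plateau (r^-1 * x) - plateau x) t) = 0.
    apply: H => x.
      move=> rx; rewrite pout// plateau_out ?subrr// (le_lt_trans _ rx)//.
      by rewrite ler_peMl.
    (* The margin between 1 and 2 leaves room for a neighbourhood of x on which both plateaus are at
       their constant value. *)
    rewrite /= in_itv/= -ler_norml => x1; near=> y.
    have y2 : `|y| <= 2.
      have : `|y| < 2.
        near: y; apply: (@cvgr_lt _ _ (nbhs x) _ (fun y : R => `|y|) `|x|).
          exact: (@norm_continuous R R).
        by rewrite (le_lt_trans x1)// ltr1n.
      exact: ltW.
    rewrite plateau_inner; first by rewrite plateau_inner// subrr.
    by rewrite normrM gtr0_norm// ler_pdivrMl// (le_trans y2)// ler_peMl.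
  pose h t := F (r^-1 * t) * plateau_hat t.
  have ch : continuous h by apply: continuousM_fun => //; exact: cs.
  have ih : mu.-integrable setT (EFin \o h).
    by apply: (@integrableM_bounded _ _ _ C) => //; exact: cs.
  have ihr := integrable_affine 0 r0 ch ih.
  have iFk : mu.-integrable setT (EFin \o (fun t => F t * plateau_hat t)).
    exact: (@integrableM_bounded _ _ _ C).
  under eq_Rintegral => t _.
    rewrite (cosintB t cp (@plateau_continuous R) (integrable_outside cp pout)
      (@integrable_plateau R)).
    rewrite (cosint_scale _ r0 (@plateau_continuous R) (@integrable_plateau R)) -/plateau_hat.
    rewrite (_ : _ * _ = r * h (r * t + 0) - F t * plateau_hat t); last first.
      by rewrite /h addr0 mulKf ?gt_eqF//; ring.
    over.
  rewrite RintegralB//; last exact: integrableM_cst.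
  rewrite RintegralZl// Rintegral_affine// mulrA mulfV ?gt_eqF// mul1r.
  by move/eqP; rewrite subr_eq0 => /eqP.
have lim : \int[mu]_t (F (n.+1%:R^-1 * t) * plateau_hat t) @[n --> \oo] -->
    \int[mu]_t (F 0 * plateau_hat t).
  apply: (@dominated_cvg_Rintegral _ _ _ (fun t => C * `|plateau_hat t|)).
  - by move=> n; apply: continuousM_fun => //; exact: cs.
  - by apply: continuousM_fun => // x; exact: cvg_cst.
  - move=> t; suff : F (n.+1%:R^-1 * t) * plateau_hat t @[n --> \oo] -->
        F (0 * t) * plateau_hat t by rewrite mul0r.
    apply: cvgM; last exact: cvg_cst.
    apply: continuous_cvg; first exact: cF.
    by apply: cvgM; [exact: cvg_harmonic|exact: cvg_cst].
  - exact/integrableM_cst/integrable_norm.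
  - by move=> n x; rewrite normrM ler_wpM2r.
rewrite mulrC -RintegralZl// -(cvg_lim _ lim)//.
by under eq_fun do rewrite step; exact: lim_cst.
Unshelve. all: by end_near. Qed.

(** Tested against a bump around the frequency 0, a constant v yields v times the positive integral
    of [plateau_hat]. The radius 1/4 lies below 1/3, where the bands with n >= 1 begin. *)
Lemma cst_spectrum_eq0 (I : set R) (v : R) : (forall x, I x -> 4^-1 < `|x|) ->
  spectrum_in I (fun=> Complex v 0) -> v = 0.
Proof.
(* The factor 1/12 shrinks the interval [-3, 3], outside which the plateau vanishes, to
   [-1/4, 1/4]. *)
move=> I4 sv; pose r : R := 12^-1.
have r0 : 0 < r by rewrite invr_gt0.
have pout (x : R) : 4^-1 < `|x| -> plateau (r^-1 * x) = 0.
  move=> x4; rewrite plateau_out// normrM gtr0_norm ?invr_gt0// /r invrK; lra.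
have := @spectrum_in_cosint I (fun=> v) (fun x => plateau (r^-1 * x)) 4^-1 sv.
have sm : smooth (fun x : R => plateau (r^-1 * x)).
  apply: (@smooth_comp _ plateau (fun x => r^-1 * x)); first exact: smooth_plateau.
  exact/smoothZ/smooth_id.
move=> /(_ sm pout) H.
have {H} : \int[mu]_t (v * cosint (fun x => plateau (r^-1 * x)) t) = 0.
  apply: H => x /I4 x4; near=> y; apply: pout.
  near: y; apply: (@cvgr_gt _ _ (nbhs x) _ (fun y : R => `|y|) `|x|) => //.
  exact: (@norm_continuous R R).
have irk := integrable_affine 0 r0 (@plateau_hat_continuous R) (@integrable_plateau_hat R).
under eq_Rintegral => t _.
  rewrite (cosint_scale _ r0 (@plateau_continuous R) (@integrable_plateau R)) -/plateau_hat.
  rewrite mulrA -[r * t]addr0.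
  over.
rewrite RintegralZl// Rintegral_affine//; last 2 first.
- exact: plateau_hat_continuous.
- exact: integrable_plateau_hat.
rewrite -mulrA [r * _]mulrA mulfV ?gt_eqF// mul1r => /eqP.
by rewrite mulf_eq0 => /orP[/eqP//|]; rewrite gt_eqF// Rintegral_plateau_hat_gt0.
Unshelve. all: by end_near. Qed.

Lemma integrable_shift (b : R) h : continuous h ->
  mu.-integrable setT (EFin \o h) ->
  mu.-integrable setT (EFin \o (fun x => h (x + b))).
Proof.
move=> ch ih; have := integrable_affine b ltr01 ch ih.
by under [X in EFin \o X]funext do rewrite mul1r.
Qed.

Lemma Rintegral_shift (b : R) h : continuous h ->
  mu.-integrable setT (EFin \o h) ->
  \int[mu]_x h (x + b) = \int[mu]_x h x.
Proof.
move=> ch ih; have := Rintegral_affine b ltr01 ch ih; rewrite invr1 mul1r => <-.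
by apply: eq_Rintegral => x _; rewrite mul1r.
Qed.

Lemma continuous_shiftr (b : R) h : continuous h -> continuous (fun x => h (x + b)).
Proof.
move=> ch; apply: (@continuous_comp_fun _ h (fun x => x + b)) => // x.
by apply: cvgD; [exact: cvg_id|exact: cvg_cst].
Qed.

(** Translation is continuous in L^1: the quadratic decay provides one dominating function for all
    shifts below 1. *)
Lemma plateau_hat_modulus (e : R) : 0 < e -> exists2 d, 0 < d &
  forall tau : R, `|tau| < d -> \int[mu]_t `|plateau_hat t - plateau_hat (t + tau)| < e.
Proof.
move=> e0; have ck := @plateau_hat_continuous R; have ik := @integrable_plateau_hat R.
have [C HC] := @plateau_hat_decay R.
have C0 : 0 <= C.
  by have := HC 0; rewrite /oneDsqr expr0n addr0 invr1 mulr1; exact: le_trans.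
pose om tau : R := \int[mu]_t `|plateau_hat t - plateau_hat (t + tau)|.
have om0 : om 0 = 0.
  rewrite /om; under eq_Rintegral do rewrite addr0 subrr normr0.
  by rewrite Rintegral_cst// mul0r.
have cint tau : continuous (fun t => `|plateau_hat t - plateau_hat (t + tau)|).
  by apply/continuous_norm_fun/continuousB_fun => //; exact: continuous_shiftr.
have dom tau t : `|tau| < 1 -> `|plateau_hat t - plateau_hat (t + tau)| <= 4 * C * (oneDsqr t)^-1.
  move=> tau1; apply: (le_trans (ler_normB _ _)).
  have -> : 4 * C * (oneDsqr t)^-1 = C * (oneDsqr t)^-1 + C * (3 * (oneDsqr t)^-1) by ring.
  apply: lerD => //; apply: (le_trans (HC _)); rewrite ler_wpM2l//.
  have ot : 0 < oneDsqr t := lt_le_trans ltr01 (oneDsqr_ge1 t).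
  have ott : 0 < oneDsqr (t + tau) := lt_le_trans ltr01 (oneDsqr_ge1 _).
  rewrite -[_^-1]mul1r ler_pdivrMr// mulrAC ler_pdivlMr// mul1r /oneDsqr.
  have : tau ^+ 2 <= 1.
    rewrite -real_normK ?num_real// -[leRHS](expr1n _ 2) lerXn2r ?nnegrE//.
    exact: ltW.
  (* The difference 3 (1 + (t + tau)^2) - (1 + t^2) is the sum of these two squares and 2 (1 -
     tau^2). *)
  by have := sqr_ge0 (t + 2 * tau); have := sqr_ge0 (t + tau); nra.
have : continuous_at 0 om.
  have := @continuity_under_integral R _ _ mu
    (fun tau t => `|plateau_hat t - plateau_hat (t + tau)|) setT measurableT (-1) 1.
  move/(_ _ _ (fun t => 4 * C * (oneDsqr t)^-1) _ _ 0); apply.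
  - move=> tau; rewrite /= in_itv/= -ltr_norml => tau1.
    apply: (@integrable_le _ _ (fun t => 4 * C * (oneDsqr t)^-1)) => //.
    + by move=> t; rewrite normr_id; exact: dom.
    + exact/integrableM_cst/integrable_oneDsqrV.
  - apply: aeW => t _ u _.
    apply: (@continuous_norm_fun _ (fun x => plateau_hat t - plateau_hat (t + x))).
    apply: continuousB_fun => [x|]; first exact: cvg_cst.
    apply: (@continuous_comp_fun _ plateau_hat (fun x => t + x)) => // x.
    by apply: cvgD; [exact: cvg_cst|exact: cvg_id].
  - exact/integrableM_cst/integrable_oneDsqrV.
  - move=> tau; rewrite /= in_itv/= -ltr_norml => tau1; apply: aeW => t _.
    by rewrite normr_id; exact: dom.
  - by rewrite inE/= in_itv/=; lra.
rewrite /continuous_at om0 => /cvgrPdist_lt/(_ e e0)/nbhs_ballP[d /= d0 Hd].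
exists d => // tau taud; have := Hd tau; rewrite /ball/= !sub0r !normrN => /(_ taud).
exact/le_lt_trans/ler_norm.
Qed.

(** Both extrema are found within one period, so a short period brings the maximum and the minimum
    close together. *)
Lemma periodic_bounds F (p : R) : 0 < p -> continuous F ->
  (forall t, F (t + p) = F t) ->
  exists s0 s1, `|s1 - s0| <= p /\ forall t, F s1 <= F t <= F s0.
Proof.
move=> p0 cF Fp.
have Fn n t : F (t + n%:R * p) = F t.
  elim: n t => [|n IH] t; first by rewrite mul0r addr0.
  by rewrite -natr1 mulrDl mul1r addrA Fp.
have Fz (z : int) t : F (t + z%:~R * p) = F t.
  case: z => n; first exact: Fn.
  by rewrite NegzE mulrNz -pmulrn mulNr -[in RHS](subrK (n.+1%:R * p) t) Fn.
have red t : exists2 t', t' \in `[0, p] & F t = F t'.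
  exists (t + (- Num.floor (t / p))%:~R * p); last by rewrite Fz.
  have := floor_itv (t / p).
  rewrite in_itv/= ler_pdivlMr// ltr_pdivrMr// mulrNz mulNr intrD1 mulrDl mul1r.
  by move=> /andP[? ?]; rewrite subr_ge0 lerBlDr; apply/andP; split => //; lra.
have cw : {within `[0, p], continuous F} by exact: continuous_subspaceT.
have [s0 s0p M] := EVT_max (ltW p0) cw; have [s1 s1p m] := EVT_min (ltW p0) cw.
exists s0, s1; split.
  move: s0p s1p; rewrite !in_itv/= => /andP[? ?] /andP[? ?].
  by rewrite ler_norml; apply/andP; split; lra.
by move=> t; have [t' t'p ->] := red t; rewrite M// m.
Qed.

(** All translates of F carry the spectral hypothesis because the reproducing formula speaks of the
    value at 0 only. *)
Lemma periodic_spectrum_constant : exists2 d : R, 0 < d &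
  forall (p : R) F, 0 < p < d -> continuous F -> (forall t, F (t + p) = F t) ->
  (forall s, spectrum_in `[-1, 1] (fun t => Complex (F (t + s)) 0)) ->
  forall s t, F s = F t.
Proof.
pose c : R := \int[mu]_t plateau_hat t.
have c0 : 0 < c := Rintegral_plateau_hat_gt0.
have ck := @plateau_hat_continuous R; have ik := @integrable_plateau_hat R.
have [d d0 Hd] := plateau_hat_modulus c0; exists d => // p F /andP[p0 pd] cF Fp sF.
have [s0 [s1 [s01 FmM]]] := periodic_bounds p0 cF Fp.
set M := F s0 in FmM; set m := F s1 in FmM.
suff MmE : M = m.
  by move=> s t; have := FmM s; have := FmM t; rewrite -/M -/m MmE -!eq_le => /eqP<- /eqP<-.
have mM : m <= M by have /andP[] := FmM s0.
apply/eqP; rewrite eq_le mM andbT -subr_le0 leNgt; apply/negP => Mm0.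
have FC t : `|F t| <= `|M| + `|m|.
  have /andP[mF FM] := FmM t; rewrite ler_norml; apply/andP; split.
    have := ler_norm (- m); rewrite normrN; have := normr_ge0 M; lra.
  have := ler_norm M; have := normr_ge0 m; lra.
pose tau := s0 - s1.
have taud : `|tau| < d by rewrite /tau distrC (le_lt_trans s01).
have rep s : c * F s = \int[mu]_t (F (t + s) * plateau_hat t).
  have := spectrum_in_reproducing (continuous_shiftr (b := s) cF) (fun x => FC (x + s)) (sF s).
  by rewrite add0r.
(* As [D] has integral 0, subtracting [mid] from F leaves the integral unchanged and bounds the
   first factor by (M - m) / 2. With the L^1 norm of [D] below c this gives c (M - m) <= c (M - m) /
   2. *)
pose mid := (M + m) / 2.
pose D t := plateau_hat t - plateau_hat (t + tau).
have ckt := continuous_shiftr (b := tau) ck; have ikt := integrable_shift tau ck ik.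
have cD : continuous D by exact: continuousB_fun.
have iD : mu.-integrable setT (EFin \o D).
  by have := integrableB measurableT ik ikt; apply: eq_integrable.
have cF0 := continuous_shiftr (b := s0) cF.
have iFD f : mu.-integrable setT (EFin \o f) -> continuous f ->
    mu.-integrable setT (EFin \o (fun t => F (t + s0) * f t)).
  move=> if_ cf; apply: (@integrableM_bounded _ _ _ (`|M| + `|m|)) => //.
have E1 : c * M - c * m = \int[mu]_t (F (t + s0) * D t).
  rewrite rep rep; under [RHS]eq_Rintegral do rewrite mulrBr.
  rewrite (RintegralB measurableT (iFD _ ik ck) (iFD _ ikt ckt)).
  congr (_ - _).
  (* Shifting t by [tau] turns F(t + s1) into F(t + s0), so the difference of the two values falls
     on the kernel. *)
  pose h t := F (t + s1) * plateau_hat t.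
  have ch : continuous h by apply: continuousM_fun => //; exact: continuous_shiftr.
  have ih : mu.-integrable setT (EFin \o h).
    by apply: (@integrableM_bounded _ _ _ (`|M| + `|m|)) => //; exact: continuous_shiftr.
  rewrite -/(h _) -(Rintegral_shift tau ch ih); apply: eq_Rintegral => t _.
  by rewrite /h /tau; congr (F _ * _); ring.
have E2 : \int[mu]_t (mid * D t) = 0.
  rewrite RintegralZl// RintegralB// (Rintegral_shift tau ck ik) subrr mulr0//.
have E3 : c * (M - m) = \int[mu]_t ((F (t + s0) - mid) * D t).
  under eq_Rintegral do rewrite mulrBl.
  rewrite RintegralB//; [|exact: iFD|exact: integrableM_cst].
  by rewrite E2 subr0 -E1 mulrBr.
have cFm : continuous (fun t => F (t + s0) - mid).
  by apply: continuousB_fun => // x; exact: cvg_cst.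
have Fm t : `|F (t + s0) - mid| <= (M - m) / 2.
  have /andP[mF FM] := FmM (t + s0); rewrite ler_norml /mid.
  by apply/andP; split; lra.
have iFm : mu.-integrable setT (EFin \o (fun t => (F (t + s0) - mid) * D t)).
  exact: (@integrableM_bounded _ _ _ ((M - m) / 2)).
have : c * (M - m) <= (M - m) / 2 * \int[mu]_t `|D t|.
  rewrite E3 (le_trans (ler_norm _))// (le_trans (le_normr_Rintegral _ iFm))//.
  rewrite -RintegralZl//; last exact: integrable_norm.
  apply: le_Rintegral => //.
  - exact: integrable_norm.
  - exact/integrableM_cst/integrable_norm.
  - by move=> t _; rewrite normrM ler_wpM2r.
have := Hd _ taud; rewrite -/(D _) => Hom.
have : (M - m) / 2 * \int[mu]_t `|D t| <= (M - m) / 2 * c.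
  by rewrite ler_wpM2l ?divr_ge0 ?ltW.
have : 0 < c * (M - m) by rewrite mulr_gt0.
nra.
Qed.

End spectra.

(** * The rotating circle *)

Definition circle (R : realType) := {p : R * R | p.1 ^+ 2 + p.2 ^+ 2 == 1}.

HB.instance Definition _ (R : realType) := [Choice of circle R by <:].

Section circle_metric.
Context {R : realType}.
Implicit Types p q : circle R.

(** The l^1 distance of the plane, for which every estimate splits into coordinates. *)
Definition circle_dist p q : R :=
  `|(val p).1 - (val q).1| + `|(val p).2 - (val q).2|.

Lemma circle_dist0 p : circle_dist p p = 0.
Proof. by rewrite /circle_dist !subrr normr0 addr0. Qed.

Lemma circle_dist_eq0 p q : circle_dist p q = 0 -> p = q.
Proof.
move/eqP; rewrite paddr_eq0// !normr_eq0 !subr_eq0 => /andP[/eqP p1 /eqP p2].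
by apply/val_inj; rewrite [LHS]surjective_pairing [RHS]surjective_pairing p1 p2.
Qed.

Lemma circle_dist_sym p q : circle_dist p q = circle_dist q p.
Proof. by rewrite /circle_dist distrC [X in _ + X]distrC. Qed.

Lemma circle_dist_triangle q p s :
  circle_dist p s <= circle_dist p q + circle_dist q s.
Proof. by rewrite /circle_dist addrACA lerD// ler_distD. Qed.

HB.instance Definition _ := isMetric.Build R (circle R)
  circle_dist0 circle_dist_eq0 circle_dist_sym circle_dist_triangle.

End circle_metric.

(** * Rotations of the circle and real functions on it *)

Section circle_flows.
Context {R : realType}.
Implicit Types (p q : circle R) (t w : R).

Lemma circle_continuous (T : topologicalType) (f : T -> circle R) :
  continuous (fun x => (val (f x)).1) -> continuous (fun x => (val (f x)).2) ->
  continuous f.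
Proof.
move=> c1 c2 x; apply/metricType_numDomainType.cvgrPdist_lt => e e0.
have e20 : 0 < e / 2 by rewrite divr_gt0.
have /cvgrPdist_lt/(_ _ e20) h1 := c1 x.
have /cvgrPdist_lt/(_ _ e20) h2 := c2 x.
near=> y; rewrite /mdist/= /circle_dist [ltRHS]splitr ltrD//.
  by near: y.
by near: y.
Unshelve. all: by end_near. Qed.

Lemma circle_fst_continuous : continuous (fun p : circle R => (val p).1).
Proof.
move=> p; apply/(@cvgrPdist_lt _ _ _ _ (nbhs_filter p)) => e e0.
have : nbhs p (ball p e) := nbhsx_ballx _ _ e0.
rewrite ballEmdist; apply: filterS => q /=.
by rewrite /mdist/= /circle_dist; apply: le_lt_trans; rewrite lerDl.
Qed.

Lemma circle_snd_continuous : continuous (fun p : circle R => (val p).2).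
Proof.
move=> p; apply/(@cvgrPdist_lt _ _ _ _ (nbhs_filter p)) => e e0.
have : nbhs p (ball p e) := nbhsx_ballx _ _ e0.
rewrite ballEmdist; apply: filterS => q /=.
by rewrite /mdist/= /circle_dist; apply: le_lt_trans; rewrite lerDr.
Qed.

Lemma cos_sin_circle t : (cos t, sin t).1 ^+ 2 + (cos t, sin t).2 ^+ 2 == 1 :> R.
Proof. by rewrite /= cos2Dsin2. Qed.

Definition circle_point t : circle R := exist _ (cos t, sin t) (cos_sin_circle t).

Lemma circle_point_continuous : continuous circle_point.
Proof.
by apply: circle_continuous; [exact: continuous_cos|exact: continuous_sin].
Qed.

Lemma circle_point_surj p : exists2 t, - pi <= t <= pi & circle_point t = p.
Proof.
case: p => -[x y] /= xy.
have xy1 : x ^+ 2 + y ^+ 2 = 1 by exact/eqP.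
have x1 : -1 <= x <= 1.
  rewrite -ler_norml -(@ler_pXn2r _ 2) ?nnegrE// expr1n real_normK ?num_real//.
  by rewrite -xy1 lerDl sqr_ge0.
have sx : sin (acos x) = `|y|.
  by rewrite sin_acos// -xy1 addrAC subrr add0r sqrtr_sqr.
have a0 := acos_ge0 x1; have api := acos_lepi x1.
have [y0|y0] := leP 0 y.
  exists (acos x); first by rewrite api andbT (le_trans _ a0)// oppr_le0 pi_ge0.
  by apply/val_inj; rewrite /= acosK ?in_itv// sx ger0_norm.
exists (- acos x); first by rewrite lerN2 api/= (le_trans _ (pi_ge0 R))// oppr_le0.
by apply/val_inj; rewrite /= cosN sinN acosK ?in_itv// sx ltr0_norm// opprK.
Qed.

Lemma circle_compact : compact [set: circle R].
Proof.
rewrite (_ : setT = circle_point @` `[- pi, pi]).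
  apply: continuous_compact; last exact: segment_compact.
  exact/continuous_subspaceT/circle_point_continuous.
apply/seteqP; split => // p _.
by have [t tpi <-] := circle_point_surj p; exists t.
Qed.

Lemma rotation_circle t p :
  let: (x, y) := val p in
  (x * cos t - y * sin t, x * sin t + y * cos t).1 ^+ 2 +
  (x * cos t - y * sin t, x * sin t + y * cos t).2 ^+ 2 == 1.
Proof.
case: p => -[x y] /= /eqP xy; apply/eqP.
transitivity ((x ^+ 2 + y ^+ 2) * (cos t ^+ 2 + sin t ^+ 2)); first by ring.
by rewrite cos2Dsin2 mulr1.
Qed.

(** The default [p] of [insubd] is never returned, since the rotated pair stays on the circle. *)
Definition rotation t p : circle R :=
  insubd p ((val p).1 * cos t - (val p).2 * sin t,
            (val p).1 * sin t + (val p).2 * cos t).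

Lemma val_rotation t p : val (rotation t p) =
  ((val p).1 * cos t - (val p).2 * sin t, (val p).1 * sin t + (val p).2 * cos t).
Proof.
rewrite /rotation insubdK// /in_mem/=.
by case: p => -[x y] xy; have := rotation_circle t (exist _ (x, y) xy).
Qed.

Lemma rotation_continuous w :
  continuous (fun z : R * circle R => rotation (w * z.1) z.2).
Proof.
have c1 : continuous (fun z : R * circle R => (val z.2).1).
  move=> z; apply: (@continuous_comp _ _ _ snd (fun p : circle R => (val p).1)).
    exact: cvg_snd.
  exact: circle_fst_continuous.
have c2 : continuous (fun z : R * circle R => (val z.2).2).
  move=> z; apply: (@continuous_comp _ _ _ snd (fun p : circle R => (val p).2)).
    exact: cvg_snd.
  exact: circle_snd_continuous.
have cw : continuous (fun z : R * circle R => w * z.1).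
  by move=> z; apply: cvgM; [exact: cvg_cst|exact: cvg_fst].
have cc : continuous (fun z : R * circle R => cos (w * z.1)).
  move=> z; apply: (@continuous_comp _ _ _ (fun z : R * circle R => w * z.1) cos).
    exact: cw.
  exact: continuous_cos.
have cs : continuous (fun z : R * circle R => sin (w * z.1)).
  move=> z; apply: (@continuous_comp _ _ _ (fun z : R * circle R => w * z.1) sin).
    exact: cw.
  exact: continuous_sin.
apply: circle_continuous.
  have -> : (fun z : R * circle R => (val (rotation (w * z.1) z.2)).1) =
      (fun z => (val z.2).1 * cos (w * z.1) - (val z.2).2 * sin (w * z.1)).
    by apply/funext => z; rewrite val_rotation.
  by move=> z; apply: cvgB; apply: cvgM; [exact: c1|exact: cc|exact: c2|exact: cs].
have -> : (fun z : R * circle R => (val (rotation (w * z.1) z.2)).2) =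
    (fun z => (val z.2).1 * sin (w * z.1) + (val z.2).2 * cos (w * z.1)).
  by apply/funext => z; rewrite val_rotation.
by move=> z; apply: cvgD; apply: cvgM; [exact: c1|exact: cs|exact: c2|exact: cc].
Qed.

Lemma rotation0 w p : rotation (w * 0) p = p.
Proof.
apply/val_inj; rewrite val_rotation mulr0 cos0 sin0 !mulr0 !mulr1 subr0 add0r.
by case: (val p).
Qed.

Lemma rotationD w r s p :
  rotation (w * (r + s)) p = rotation (w * r) (rotation (w * s) p).
Proof.
by apply/val_inj; rewrite !val_rotation/= mulrDr cosD sinD; congr pair; ring.
Qed.

(** The angular speed 2 pi / p gives the period p for (i), the speed 0 the trivial flow for (ii). *)
Definition circle_flow w : real_flow R :=
  @RealFlow R (circle R) (fun t => rotation (w * t)) circle_compact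
    (@rotation_continuous w) (rotation0 w) (rotationD w).

(** Borsuk-Ulam in dimension one: the difference of the values at antipodal points changes sign over
    a half turn, so it vanishes somewhere. *)
Lemma circle_noninjective (v : circle R -> R) : continuous v -> ~ injective v.
Proof.
move=> cv vI.
pose G t := v (circle_point t) - v (circle_point (t + pi)).
have cG : continuous G.
  have cp : continuous (fun t => v (circle_point t)).
    by move=> t; apply: continuous_comp; [exact: circle_point_continuous|exact: cv].
  by apply: continuousB_fun => //; exact: (continuous_shiftr (b := pi) cp).
have Gpi : G pi = - G 0.
  rewrite /G add0r opprB; congr (_ - v _).
  by apply/val_inj; rewrite /= cosDpi sinDpi cospi sinpi cos0 sin0 opprK oppr0.
have [||t _ Gt] := @IVT _ G 0 pi 0 (pi_ge0 R).
- exact: continuous_subspaceT.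
- rewrite Gpi ge_min le_max oppr_le0 oppr_ge0.
  by rewrite !le_total.
have /vI : v (circle_point t) = v (circle_point (t + pi)).
  by apply/eqP; rewrite -subr_eq0; apply/eqP.
move=> [ct st]; have := cos2Dsin2 t; move: ct st; rewrite cosDpi sinDpi => ct st.
have -> : cos t = 0 by lra.
have -> : sin t = 0 by lra.
by rewrite expr0n addr0 => /eqP; rewrite eq_sym oner_eq0.
Qed.

End circle_flows.

(** * Non-universality of the two products *)

Section non_universality.
Context {R : realType}.

Lemma band_limited_not_universal :
  ~ universal (@translation R) (band_limited_prod (fun _ : nat => `[-1, 1]%classic)).
Proof.
have [d d0 H] := @periodic_spectrum_constant R.
pose p : R := d / 2; have p0 : 0 < p by rewrite divr_gt0.
pose w : R := 2 * pi / p.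
move=> /(_ (circle_flow w)) [phi [_ phiI _ phiA phiT]].
have act t y n u : (phi (rotation (w * t) y) n : R -> R) u = (phi y n : R -> R) (u + t).
  by rewrite (phiT t y).
pose y0 : circle R := circle_point 0.
have wp : w * p = pi *+ 2 by rewrite /w divfK ?gt_eqF// mulr_natl.
have cst n s t : (phi y0 n : R -> R) s = (phi y0 n : R -> R) t.
  apply: (H p); first by rewrite p0 /p; lra.
  - by have [] := phiA _ (imageT phi y0) n.
  - move=> u; rewrite -act wp; congr ((phi _ n : R -> R) u).
    apply/val_inj; rewrite val_rotation cos2pi sin2pi !mulr0 !mulr1 subr0 add0r.
    by case: (val y0).
  (* By equivariance the translate by u is a coordinate of the image of a rotated point, so its
     spectrum is known too. *)
  - move=> u; have [_ + _] := phiA _ (imageT phi (rotation (w * u) y0)) n.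
    by congr (spectrum_in _ _); apply/funext => x; rewrite act.
(* Half a period carries [y0] to its antipode, yet constant coordinates do not notice it;
   injectivity is violated. *)
have : phi (rotation (w * (p / 2)) y0) = phi y0.
  by apply/funext => n; apply/funext => u; rewrite act; exact: cst.
move=> /phiI /(congr1 (fun q => (val q).1)); rewrite val_rotation/=.
have -> : w * (p / 2) = pi by rewrite mulrA wp mulr2n; field.
by rewrite cos0 sin0 cospi sinpi mul1r mul0r subr0; lra.
Qed.

(** Uniform convergence on compact sets contains convergence at a point, as a singleton is
    compact. *)
Lemma signals_eval_continuous (T : topologicalType) (phi : T -> signals R) n t :
  continuous phi -> continuous (fun y => (phi y n : R -> R) t).
Proof.
move=> cphi y.
have c1 : (fun y => phi y n) @ y --> phi y n.
  apply: (@cvg_comp _ _ _ phi (fun x : signals R => x n) _ (nbhs (phi y))).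
    exact: cphi.
  exact: (@proj_continuous nat (fun=> signal R) n (phi y)).
have FF : Filter ((fun y => phi y n : R -> R) @ y).
  by apply: fmap_filter; exact: nbhs_filter.
have /(@fam_cvgP R R compact _ (phi y n : R -> R) FF)/(_ [set t] (@compact_set1 R t)) := c1.
by rewrite uniform_set1.
Qed.

Lemma gapped_band_limited_not_universal :
  ~ universal (@translation R)
      (band_limited_prod (fun n : nat =>
         `[- (n%:R / 3) - 1 / 2, - (n%:R / 3)]%classic `|`
         `[n%:R / 3, n%:R / 3 + 1 / 2]%classic)).
Proof.
move=> /(_ (circle_flow 0)) [phi [cphi phiI _ phiA phiT]].
(* Every point is fixed by the trivial flow, so each coordinate of its image is invariant under all
   translations. *)
have cst y n u : (phi y n : R -> R) u = (phi y n : R -> R) 0.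
  have := phiT u y; rewrite [flow_act _ _](_ : _ = y); last first.
    by rewrite /= mul0r -(mul0r 0) rotation0.
  by move=> /(congr1 (fun x : signals R => (x n : R -> R) 0)); rewrite /translation add0r.
apply: (@circle_noninjective R (fun y => (phi y 0%N : R -> R) 0)).
  exact: signals_eval_continuous.
move=> y z yz; apply: phiI; apply/funext => n; apply/funext => u.
rewrite !(cst _ _ u); case: n => [//|n].
have eq0 x : (phi x n.+1 : R -> R) 0 = 0.
  have [_ + _] := phiA _ (imageT phi x) n.+1.
  rewrite (_ : (fun t => _) = fun=> Complex ((phi x n.+1 : R -> R) 0) 0); last first.
    by apply/funext => t; rewrite cst.
  (* With index n + 1 >= 1, the band stays at distance at least 1/3 from 0. *)
  apply: cst_spectrum_eq0 => t.
  have n1 : 1 <= n.+1%:R :> R by rewrite ler1n.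
  rewrite /= !in_itv/= => -[|] /andP[a b].
    by rewrite ltr0_norm; lra.
  by rewrite gtr0_norm; lra.
by rewrite !eq0.
Qed.

End non_universality.

Theorem mainTheorem4 (R : realType) :
  ~ universal (@translation R) (band_limited_prod (fun _ : nat => `[-1, 1]%classic))
  /\
  ~ universal (@translation R)
      (band_limited_prod (fun n : nat =>
         `[- (n%:R / 3) - 1 / 2, - (n%:R / 3)]%classic `|`
         `[n%:R / 3, n%:R / 3 + 1 / 2]%classic)).
Proof.
split; first exact: band_limited_not_universal.
exact: gapped_band_limited_not_universal.
Qed.
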